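(* Let $H$ be the complete $(n-1)$-uniform hypergraph on the vertex set $\{1,\dots,n\}$. Then $$\dim HC_0(\Delta(H))=\binom{n}{1}=n\qquad\text{and}\qquad \dim HC_{-1}(\Delta(H))=\binom{n}{0}=1.$$
   Context: All vector spaces are over a fixed field of characteristic zero. A hypergraph $H=(V,E)$ consists of a vertex set $V=\{1,\dots,n\}$ and a set $E$ of subsets of $V$ (hyperedges). It is complete $k$-uniform if its hyperedges are exactly the $k$-element subsets of $V$. For $r\ge -1$ consider ordered set partitions $(B_1,\dots,B_{r+2})$ of $\{1,\dots,n\}$ into nonempty blocks, at least one of which contains a hyperedge of $H$, modulo the signed cyclic relation $(B_1,\dots,B_{r+2})\sim(-1)^{r+1}(B_{\sigma(1)},\dots,B_{\sigma(r+2)})$, where $\sigma=(1,2,\dots,r+2)$ is the cyclic permutation. The class is written $[B_1,\dots,B_{r+2}]$ and is represented by the unique representative with $1\in B_1$. Let $C_r$ be the vector space with basis these classes $[B_1,\dots,B_{r+2}]$ with $1\in B_1$, and let $$\partial_r([B_1,\dots,B_{r+2}])=\sum_{i=1}^{r+1}(-1)^{i+1}[B_1,\dots,B_i\cup B_{i+1},\dots,B_{r+2}]+(-1)^{r+3}[B_1\cup B_{r+2},B_2,\dots,B_{r+1}]$$ for $r\ge 0$, and $\partial_{-1}=0$. The cyclic coloring complex $\Delta(H)$ is the chain complex $(C_r,\partial_r)$, and $HC_r(\Delta(H))=\ker\partial_r/\operatorname{im}\partial_{r+1}$.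
   Formalization: The claim dim HC_0 = n is proved for n ≥ 3, since it fails for n = 1 (C_0 = 0, dimension 0) and for n = 2 (C_0 is spanned by [1|2], dimension 1); the claim dim HC_{-1} = 1 is proved for all n ≥ 1. *)

(* Defs.v *)
From HB Require Import structures.
From mathcomp Require Import all_boot all_order all_algebra zify.
Set Implicit Arguments.
Unset Strict Implicit.
Unset Printing Implicit Defensive.
Import GRing.Theory.

Local Open Scope ring_scope.

(* The vertex set {1, ..., n} is 'I_n: the vertex v of the text is the ordinal
   of value v - 1. *)
Definition hypergraph (n : nat) : Type := {set {set 'I_n}}.

Definition complete_uniform (n k : nat) : hypergraph n :=
  [set e : {set 'I_n} | #|e| == k].

Section OrderedSetPartitions.
Variable n : nat.
Implicit Types (H : hypergraph n) (s : seq {set 'I_n}).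

Definition ordered_partition s : bool :=
  [&& all (fun B : {set 'I_n} => B != set0) s,
      pairwise (fun A B : {set 'I_n} => [disjoint A & B]) s
    & \bigcup_(B <- s) (B : {set 'I_n}) == [set: 'I_n]].

Definition has_edge H s : bool :=
  has (fun B : {set 'I_n} => [exists e in H, e \subset B]) s.

Definition has_vertex1 (B : {set 'I_n}) : bool :=
  [exists v in B, val v == 0%N].

Definition admissible H s : bool := ordered_partition s && has_edge H s.

Definition normalized H s : bool := admissible H s && has_vertex1 (head set0 s).

Definition merge_adjacent (i : nat) s : seq {set 'I_n} :=
  take i s ++ (nth set0 s i :|: nth set0 s i.+1) :: drop i.+2 s.

Definition merge_ends s : seq {set 'I_n} :=
  (head set0 s :|: last set0 s) :: behead (take (size s).-1 s).

End OrderedSetPartitions.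

Section CyclicColoringComplex.
Variables (F : fieldType) (n : nat) (H : hypergraph n).
Implicit Types (p q : nat) (s : seq {set 'I_n}).

(* Chains are first indexed by the number p = r + 2 of blocks, r being the
   homological degree.  As a sequence without blocks contains no hyperedge,
   there are no nonzero chains for p = 0, that is, C_{-2} = 0.
   The class of an ordered set partition is represented by its unique cyclic
   rotation with vertex 1 in the first block. *)
Definition cell p : Type := {b : p.-tuple {set 'I_n} | normalized H b}.
HB.instance Definition _ p := Finite.on (cell p).

Definition chain p : Type := {ffun cell p -> F^o}.
HB.instance Definition _ p := Vector.on (chain p).

Definition cell_seq p (b : cell p) : seq {set 'I_n} := val (val b).

(* [bracket p s] is the class [B_1, ..., B_p] for s = (B_1, ..., B_p) admissible
   (and 0 otherwise).  The cyclic relation is B ~ (-1)^(p-1) (rot 1 B), so the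
   class is a signed basis element, the sign being determined by the number of
   rotations needed to bring the block of vertex 1 to the front; see
   [bracket_cyclic]. *)
Definition bracket p s : chain p :=
  let i := find (@has_vertex1 n) s in
  [ffun b => (-1) ^+ (i * p.-1) * (cell_seq b == rot i s)%:R].

(* Here p = size s = r + 2, so that (-1)^(p+1) = (-1)^(r+3). *)
Definition boundary_of_cell q s : chain q :=
  \sum_(i < (size s).-1) (-1) ^+ i *: bracket q (merge_adjacent i s)
    + (-1) ^+ (size s).+1 *: bracket q (merge_ends s).

Definition boundary_fun p q (c : chain p) : chain q :=
  \sum_(b : cell p) (c b : F) *: boundary_of_cell q (cell_seq b).

(* Only meaningful for p = q + 1; q is a separate argument so that integer
   degrees can be used below. *)
Definition boundary_map p q : 'Hom(chain p, chain q) :=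
  linfun (@boundary_fun p q).

Definition blocks (r : int) : nat :=
  match r with Posz k => k.+2 | Negz 0 => 1 | Negz _ => 0 end.

Definition chain_deg (r : int) : vectType F := chain (blocks r).

(* For r = -1 the target is C_{-2} = 0, which gives the convention that the
   boundary is 0 in degree -1. *)
Definition cycles (r : int) : {vspace chain_deg r} :=
  lker (boundary_map (blocks r) (blocks (r - 1))).

Definition boundaries (r : int) : {vspace chain_deg r} :=
  limg (boundary_map (blocks (r + 1)) (blocks r)).

(* The quotient cycles / boundaries is realized as the complement of the
   boundaries in the cycles (the former lie in the latter by
   [boundaries_sub_cycles]); [HC_proj] is the quotient map, see
   [HC_proj_surjective] and [HC_proj_kernel]. *)
Definition HC (r : int) : {vspace chain_deg r} := (cycles r :\: boundaries r)%VS.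

Definition HC_proj (r : int) : 'End(chain_deg r) :=
  addv_pi1 (cycles r) (boundaries r).

End CyclicColoringComplex.

Section BlockSequences.
Variables (n : nat) (H : hypergraph n).
Implicit Types (s t : seq {set 'I_n}) (A B : {set 'I_n}).

Lemma admissible_rot i s : admissible H (rot i s) = admissible H s.
Proof.
rewrite -{2}(cat_take_drop i s) /rot.
rewrite /admissible /ordered_partition /has_edge !all_cat !has_cat !big_cat /=.
rewrite setUC orbC andbC [in RHS]andbC; congr (_ && _).
rewrite (andbC (all _ (drop i s))) !pairwise_cat; congr [&& _, _ & _].
rewrite (andbC (pairwise _ (drop i s))); congr (_ && _).
by rewrite allrelC; apply: eq_allrel => A B; rewrite disjoint_sym.
Qed.

Lemma admissible_merge A B s :
  admissible H [:: A, B & s] -> admissible H (A :|: B :: s).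
Proof.
rewrite /admissible /ordered_partition /has_edge /= !big_cons setUA.
case/andP=> /and3P[/and3P[A0 _ sN0] /and3P[/andP[_ As] Bs ss] ->] e.
rewrite sN0 ss !andbT -andbA; apply/and3P; split.
- by apply: contraNneq A0 => /eqP; rewrite setU_eq0 => /andP[].
- apply/allP=> D Ds; rewrite -setI_eq0 setIUl setU_eq0 !setI_eq0.
  by rewrite (allP As) // (allP Bs).
case/or3P: e => [/exists_inP[e eH eA]|/exists_inP[e eH eB]|->].
- apply/orP; left; apply/exists_inP; exists e => //.
  exact: subset_trans eA (subsetUl _ _).
- apply/orP; left; apply/exists_inP; exists e => //.
  exact: subset_trans eB (subsetUr _ _).
by rewrite orbT.
Qed.

Lemma has_vertex1U A B : has_vertex1 (A :|: B) = has_vertex1 A || has_vertex1 B.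
Proof.
apply/exists_inP/orP => [[v]|[] /exists_inP[v vA v0]]; last 2 first.
- by exists v; rewrite // inE vA.
- by exists v; rewrite // inE vA orbT.
by rewrite inE => /orP[] vA v0; [left|right]; apply/exists_inP; exists v.
Qed.

Lemma merge_adjacent_cat s A B t :
  merge_adjacent (size s) (s ++ [:: A, B & t]) = s ++ A :|: B :: t.
Proof.
rewrite /merge_adjacent take_size_cat // !nth_cat ltnn subnn ltnNge leqnSn /=.
by rewrite subSnn /= -{1}[(size s).+2]addn2 addnC -drop_drop drop_size_cat //= drop0.
Qed.

Lemma merge_ends_rcons A s B : merge_ends (A :: rcons s B) = A :|: B :: s.
Proof. by rewrite /merge_ends /= last_rcons size_rcons /= -cats1 take_size_cat. Qed.

(* All terms of the boundary formula, numbered from 0: the last one is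
   [merge_ends], the others are [merge_adjacent]. *)
Definition face i s :=
  if i == (size s).-1 then merge_ends s else merge_adjacent i s.

Lemma split_adjacent i s : (i.+1 < size s)%N ->
  exists s1 A B s2, s = s1 ++ [:: A, B & s2] /\ size s1 = i.
Proof.
move=> lt_i; exists (take i s), (nth set0 s i), (nth set0 s i.+1), (drop i.+2 s).
by rewrite -!drop_nth ?cat_take_drop ?size_take ?(ltnW lt_i) //; lia.
Qed.

Lemma split_ends s : (1 < size s)%N -> exists A t B, s = A :: rcons t B.
Proof.
by case: s => // A s; case/lastP: s => // t B _; exists A, t, B.
Qed.

Lemma size_face i s : (i < size s)%N -> (1 < size s)%N ->
  size (face i s) = (size s).-1.
Proof.
move=> lt_i lt_1; rewrite /face; case: eqP => [_|ne].
  case/split_ends: lt_1 => A [t [B ->]].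
  by rewrite merge_ends_rcons /= size_rcons.
have [|s1 [A [B [s2 [-> <-]]]]] := @split_adjacent i s; first by lia.
by rewrite merge_adjacent_cat !size_cat /=; lia.
Qed.

Lemma normalized_face i s : (i < size s)%N -> (1 < size s)%N ->
  normalized H s -> normalized H (face i s).
Proof.
move=> lt_i lt_1; rewrite /normalized /face; case: eqP => [_|ne].
  case/split_ends: lt_1 => A [t [B ->]].
  rewrite merge_ends_rcons /= has_vertex1U => /andP[adm ->]; rewrite andbT.
  rewrite setUC; apply: admissible_merge.
  rewrite -rcons_cons -cats1 -(admissible_rot (size (A :: t))) in adm.
  by rewrite rot_size_cat in adm.
have [|s1 [A [B [s2 [-> <-]]]]] := @split_adjacent i s; first by lia.
rewrite merge_adjacent_cat => /andP[adm v1]; apply/andP; split.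
  rewrite -(admissible_rot (size s1)) rot_size_cat /= in adm.
  rewrite -(admissible_rot (size s1)) rot_size_cat /=.
  exact: admissible_merge.
by case: s1 v1 {adm} => //=; rewrite has_vertex1U => ->.
Qed.

Lemma nth_face i s k : (i < size s)%N -> (1 < size s)%N ->
  (k < (size s).-1)%N ->
  nth set0 (face i s) k =
  if i == (size s).-1 then
    if k == 0%N then nth set0 s 0 :|: nth set0 s (size s).-1 else nth set0 s k
  else if (k < i)%N then nth set0 s k
  else if k == i then nth set0 s i :|: nth set0 s i.+1 else nth set0 s k.+1.
Proof.
move=> lt_i lt_1 lt_k; rewrite /face; case: eqP => [_|ne].
  case/split_ends: lt_1 lt_k => A [t [B ->]]; rewrite /= size_rcons /= => lt_k.
  rewrite merge_ends_rcons nth_rcons ltnn eqxx.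
  by case: k lt_k => //= k lt_k; rewrite nth_rcons ifT.
have lt_i1 : (i.+1 < size s)%N by lia.
rewrite /merge_adjacent nth_cat size_take lt_i; case: ltnP => [lt_ki|le_ik].
  by rewrite nth_take.
case: eqP => [->|ne_ki]; first by rewrite subnn.
have -> : (k - i = (k - i.+1).+1)%N by lia.
by rewrite /= nth_drop; congr nth; lia.
Qed.

Lemma face_face i j s : (i < j)%N -> (j < size s)%N -> (2 < size s)%N ->
  face i (face j s) = face j.-1 (face i s).
Proof.
move=> lt_ij lt_j lt_2.
have sj : size (face j s) = (size s).-1 by apply: size_face; lia.
have si : size (face i s) = (size s).-1 by apply: size_face; lia.
case: j => // j in lt_ij lt_j sj *; rewrite /=.
case sz : (size s) => [|[|[|m]]] // in lt_j lt_2 si sj *.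
apply: (@eq_from_nth _ set0); first by rewrite !size_face; lia.
rewrite size_face ?sj; try lia.
move=> k lt_k.
rewrite /= in lt_k *.
repeat (match goal with
| |- context [if ?b then _ else _] => case: (boolP b) => ?; try (exfalso; lia)
| |- context [nth set0 (face ?a s) ?b] =>
   rewrite (@nth_face a s b) ?sz /=; try lia
| |- context [nth set0 (face ?a ?t) ?b] =>
   rewrite (@nth_face a t b) ?sj ?si /=; try lia
end).
all: try by [].
- have -> : i = m.+1 by lia.
  by rewrite -setUA (setUC (nth _ _ m.+2)).
- have -> : i = 0%N by lia.
  by rewrite -!setUA (setUC (nth _ _ m.+2)).
- have -> : j = i by lia.
  by rewrite setUA.
Qed.

End BlockSequences.

Section ChainComplex.
Variables (F : fieldType) (n : nat) (H : hypergraph n).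
Implicit Types (p q : nat) (s : seq {set 'I_n}).

Lemma cell_seqP p (b : cell H p) : size (cell_seq b) = p /\ normalized H (cell_seq b).
Proof. by case: b => -[t st] nt; split=> //; apply/eqP. Qed.

Lemma has_has_vertex1 s : ordered_partition s -> (0 < n)%N ->
  has (@has_vertex1 n) s.
Proof.
move=> /and3P[_ _ /eqP cs] n_gt0; have := in_setT (Ordinal n_gt0).
rewrite -cs; elim: s {cs} => [|A s IHs]; [by rewrite big_nil inE|].
rewrite big_cons inE => /orP[vA|/IHs /= ->]; last exact: orbT.
by apply/orP; left; apply/exists_inP; exists (Ordinal n_gt0).
Qed.

Lemma has_vertex1_head A s : ordered_partition (A :: s) -> has_vertex1 A ->
  ~~ has (@has_vertex1 n) s.
Proof.
move=> /and3P[_ /=/andP[/allP As _] _] /exists_inP[v vA /eqP v0].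
apply/hasPn => B Bs; apply/exists_inP => -[w wB /eqP w0].
have vw : v = w by apply: val_inj; rewrite v0 w0.
by have /disjointFr/(_ vA) := As _ Bs; rewrite vw wB.
Qed.

Lemma bracket_normalized q s : normalized H s ->
  bracket F H q s = [ffun b => (cell_seq b == s)%:R].
Proof.
case/andP=> /andP[_ e]; case: s e => //= A s _ v1.
by apply/ffunP=> b; rewrite !ffunE /= v1 mul0n expr0 mul1r rot0.
Qed.

Lemma bracket_cyclic q s : size s = q -> ordered_partition s ->
  bracket F H q s = (-1) ^+ q.-1 *: bracket F H q (rot 1 s).
Proof.
case: s => [|A s] /= <- os; apply/ffunP=> b.
  by rewrite !ffunE /= expr0 [RHS]mul1r.
rewrite !ffunE /= -[RHS]/(_ * _) mulrA -exprD rot1_cons -cats1 find_cat.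
have n_gt0 : (0 < n)%N.
  case/and3P: os => /= /andP[/set0Pn[v _] _] _ _.
  exact: leq_ltn_trans (ltn_ord v).
have [v1|nv1] := boolP (has_vertex1 A); last first.
  have := has_has_vertex1 os n_gt0; rewrite /= (negPf nv1) /= => v1s.
  rewrite v1s -mulSn; congr (_ * (_ == _)%:R).
  rewrite /rot /= drop_cat take_cat.
  by move: v1s; rewrite has_find => ->; rewrite -catA.
rewrite (negPf (has_vertex1_head os v1)) /= v1 addn0 mul0n rot0 rot_size_cat.
by rewrite -mulnS -[X in _ = X * _]signr_odd oddM oddS andbN.
Qed.

Lemma boundary_fun_linear p q : linear (@boundary_fun F n H p q).
Proof.
move=> a c d; rewrite /boundary_fun scaler_sumr -big_split /=.
by apply: eq_bigr => b _; rewrite !ffunE scalerDl scalerA.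
Qed.

HB.instance Definition _ p q :=
  GRing.isLinear.Build F (chain F H p) (chain F H q) _ _
    (@boundary_fun_linear p q).

Lemma boundary_bracket p q s : size s = p -> normalized H s ->
  boundary_map F H p q (bracket F H p s) = boundary_of_cell F H q s.
Proof.
move=> sp ns; rewrite lfunE /= /boundary_fun bracket_normalized //.
have s_p : size s == p by apply/eqP.
pose b : cell H p := Sub (Tuple s_p) ns.
rewrite (bigD1 b) //= big1 ?addr0 => [|c /negPf cb].
  by rewrite ffunE eqxx scale1r.
rewrite ffunE; case: eqP => [cs|]; last by rewrite scale0r.
by case/eqP: cb; do 2!apply: val_inj.
Qed.

Lemma boundary_of_cell_face q s : (0 < size s)%N ->
  boundary_of_cell F H q s =
    \sum_(i < size s) (-1) ^+ i *: bracket F H q (face i s).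
Proof.
case: s => // A s _; rewrite /boundary_of_cell big_ord_recr /=; congr (_ + _).
  by apply: eq_bigr => i _; rewrite /face /= ltn_eqF.
by rewrite /face /= eqxx !exprS mulN1r mulN1r opprK.
Qed.

Lemma alternating_sum0 (V : lmodType F) m (G : nat -> nat -> V) :
  (forall i j, (i < j)%N -> (j <= m)%N -> G i j = G j.-1 i) ->
  \sum_(j < m.+1) \sum_(i < m) (-1) ^+ (i + j) *: G i j = 0.
Proof.
move=> GE.
transitivity (\sum_(j < m.+1) \sum_(i < m | (i < j)%N) (-1) ^+ (i + j) *: G i j +
   \sum_(j < m.+1) \sum_(i < m | (j <= i)%N) (-1) ^+ (i + j) *: G i j).
  rewrite -big_split; apply: eq_bigr => j _ /=.
  rewrite (bigID (fun i : 'I_m => (i < j)%N)) /=; congr (_ + _).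
  by apply: eq_bigl => i; rewrite -leqNgt.
rewrite big_ord_recl big_pred0 // add0r [X in _ + X]big_ord_recr /=.
rewrite [X in _ + (_ + X)]big_pred0 ?addr0; last by move=> i; rewrite leqNgt ltn_ord.
rewrite [X in _ + X](exchange_big_dep predT) //= -big_split big1 //= => j _.
rewrite -big_split big1 //= => i; rewrite /bump /= add1n ltnS => le_ij.
by rewrite GE // addnS exprS mulN1r scaleNr (addnC i) addNr.
Qed.

Lemma chain0_eq0 (c : chain F H 0) : c = 0.
Proof.
by apply/ffunP => -[t nt]; exfalso; move: nt; rewrite (tuple0 t) => /andP[/andP[]].
Qed.

Lemma boundary_map_comp q (c : chain F H q.+2) :
  boundary_map F H q.+1 q (boundary_map F H q.+2 q.+1 c) = 0.
Proof.
case: q c => [|m] c; first exact: chain0_eq0.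
have -> : c = \sum_b (c b : F) *: bracket F H _ (cell_seq b).
  apply/ffunP=> b; rewrite sum_ffunE (bigD1 b) //= big1 ?addr0 => [|d /negPf db].
    have [_ nb] := cell_seqP b.
    by rewrite ffunE bracket_normalized // ffunE eqxx /= [RHS]mulr1.
  have [_ nb] := cell_seqP d.
  rewrite ffunE bracket_normalized // ffunE; case: eqP => [E|_]; last exact: mulr0.
  by move: db; rewrite -(inj_eq val_inj) -(inj_eq val_inj) /= -[X in X == _]E eqxx.
rewrite !linear_sum big1 // => b _; rewrite !linearZ /=.
have [sb nb] := cell_seqP b; move: (cell_seq b) sb nb => s sb nb.
rewrite boundary_bracket // boundary_of_cell_face ?sb // linear_sum /=.
rewrite [X in _ *: X](_ : _ = 0) ?scaler0 //.
rewrite -[RHS](@alternating_sum0 _ m.+2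
  (fun i j => bracket F H m.+1 (face i (face j s)))) => [|i j lt_ij lt_j]; last first.
  by rewrite face_face ?sb.
apply: eq_bigr => j _; rewrite linearZ /=.
have sj : size (face j s) = m.+2 by rewrite size_face sb.
rewrite boundary_bracket ?normalized_face ?sb // boundary_of_cell_face sj //.
by rewrite scaler_sumr; apply: eq_bigr => i _; rewrite scalerA -exprD addnC.
Qed.

Lemma boundary_map_comp_blocks (r : int) (c : chain_deg F H (r + 1)) :
  boundary_map F H (blocks r) (blocks (r - 1))
    (boundary_map F H (blocks (r + 1)) (blocks r) c) = 0.
Proof.
case: r => [k|[|k]] in c *.
- have Ep : (Posz k + 1 = Posz k.+1)%R by lia.
  have Em : blocks (Posz k - 1) = k.+1 by case: k {c Ep} => //= k; rewrite subn1.
  move: c; rewrite /chain_deg Ep Em => c; exact: boundary_map_comp.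
- exact: chain0_eq0.
- exact: chain0_eq0.
Qed.

Lemma boundaries_sub_cycles (r : int) : (boundaries F H r <= cycles F H r)%VS.
Proof.
apply/subvP=> _ /memv_imgP[c _ ->]; rewrite memv_ker; apply/eqP.
exact: boundary_map_comp_blocks.
Qed.

Lemma HC_proj_surjective (r : int) :
  (HC_proj F H r @: cycles F H r)%VS = HC F H r.
Proof.
apply/vspaceP=> u; apply/memv_imgP/idP=> [[v _ ->]|Hu]; first exact: memv_pi.
exists u; first exact: subvP (diffvSl _ _) _ Hu.
by rewrite /HC_proj /addv_pi1 daddv_pi_id // capv_diff.
Qed.

Lemma HC_proj_kernel (r : int) c :
  c \in cycles F H r -> (HC_proj F H r c == 0) = (c \in boundaries F H r).
Proof.
move=> Zc; have cE : c \in (cycles F H r + boundaries F H r)%VS.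
  exact: subvP (addvSl _ _) _ Zc.
apply/eqP/idP => [p0|Bc].
  by rewrite -(addv_pi1_pi2 cE) [X in X + _]p0 add0r memv_pi2.
by apply: (addIr c); rewrite add0r -{2}(addv_pi2_id (cycles F H r) Bc) addv_pi1_pi2.
Qed.

End ChainComplex.

(* Main.v *)
(* An ordered partition having a block with at least n - 1 vertices is either the
   whole vertex set or consists of a singleton and its complement.  Hence C_1 = 0
   and C_0 has a basis indexed by the vertices.  The two faces of a pair of
   blocks cancel, so all boundary maps between these spaces vanish and the
   homology in degrees 0 and -1 is C_0 and C_{-1}. *)
Require Import Defs.
From mathcomp Require Import all_boot all_order all_algebra.
From mathcomp Require Import zify.
Set Implicit Arguments.
Unset Strict Implicit.
Unset Printing Implicit Defensive.
Import GRing.Theory.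
Local Open Scope ring_scope.

Section Chains.
Variables (F : fieldType) (n : nat) (H : hypergraph n).

Lemma dim_chain p : \dim {: chain F H p} = #|{: cell H p}|.
Proof. by rewrite dimvf /dim /= muln1. Qed.

Lemma chain_eq0 p (c : chain F H p) : #|{: cell H p}| = 0%N -> c = 0.
Proof.
move=> /eqP; rewrite -dim_chain dimv_eq0 => /eqP C0; apply/eqP.
by rewrite -memv0 -C0 memvf.
Qed.

Lemma boundary_pair_eq0 q : boundary_map F H 2 q = 0.
Proof.
apply/lfunP => c; rewrite lfunE zero_lfunE /= /boundary_fun big1 // => b _.
have [sb _] := cell_seqP b; case: (cell_seq b) sb => [|A [|B []]] //= _.
(* Merging adjacent blocks and merging the ends of [[:: A; B]] both give [[:: A :|: B]], with signs
   [(-1)^0] and [(-1)^3]. *)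
rewrite /boundary_of_cell big_ord1 /= expr0 scale1r -signr_odd expr1 scaleN1r.
by rewrite subrr scaler0.
Qed.

Lemma dim_HC_full r :
    boundary_map F H (blocks r) (blocks (r - 1)) = 0 ->
    boundary_map F H (blocks (r + 1)) (blocks r) = 0 ->
  \dim (HC F H r) = #|{: cell H (blocks r)}|.
Proof.
move=> out0 in0; rewrite -dim_chain /HC /boundaries in0 lim0g.
have := dimv_cap_compl (cycles F H r) 0; rewrite capv0 dimv0 add0n => ->.
congr (\dim _); apply/vspaceP => c.
by rewrite memvf memv_ker out0 zero_lfunE eqxx.
Qed.

End Chains.

Lemma card_cell n (H : hypergraph n) p :
  #|{: cell H p}| = #|[set t : p.-tuple {set 'I_n} | normalized H t]|.
Proof. by rewrite card_sig cardsE. Qed.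

Lemma card_bigcup_pairwise (T : finType) (s : seq {set T}) :
    pairwise (fun A B : {set T} => [disjoint A & B]) s ->
  #|\bigcup_(B <- s) B| = (\sum_(B <- s) #|B|)%N.
Proof.
elim: s => [|A s IHs] /=; first by rewrite !big_nil cards0.
case/andP=> /allP As /IHs {IHs}; rewrite !big_cons => <-; apply/eqP.
(* The equality case of [leq_card_setU] is disjointness, so it remains to place the union of the
   later blocks inside [~: A]. *)
rewrite leq_card_setU disjoint_sym disjoints_subset big_seq.
elim/big_ind: _ => [|X Y XA YA|B /As]; first exact: sub0set.
  by rewrite subUset XA.
by rewrite disjoint_sym disjoints_subset.
Qed.

Section CompleteHypergraph.
Variable n : nat.
Hypothesis n_gt0 : (0 < n)%N.
Implicit Types (A B : {set 'I_n}) (s : seq {set 'I_n}).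

Let H := complete_uniform n n.-1.

(** Any [k] distinct elements of a block form a hyperedge, so only block sizes matter from here
    on. *)
Lemma has_edge_complete k s :
  has_edge (complete_uniform n k) s = has (fun B => k <= #|B|)%N s.
Proof.
apply: eq_has => B; apply/exists_inP/idP => [[e]|].
  by rewrite inE => /eqP <- /subset_leq_card.
case/card_geqP => r [ur sr rB]; exists [set x in r].
  by rewrite inE cardsE (card_uniqP ur) sr.
by apply/subsetP => x; rewrite inE => /rB.
Qed.

Lemma has_vertex1E B : has_vertex1 B = (Ordinal n_gt0 \in B).
Proof.
apply/exists_inP/idP => [[v vB /eqP v0]|]; last by exists (Ordinal n_gt0).
by have -> : Ordinal n_gt0 = v by apply: val_inj.
Qed.

Lemma normalized1 A : normalized H [:: A] = (A == [set: 'I_n]).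
Proof.
rewrite /normalized /admissible has_edge_complete has_vertex1E.
rewrite /ordered_partition /= big_seq1 !andbT !orbF.
apply/andP/idP => [[/andP[/andP[]]] //|/eqP ->].
by rewrite eqxx cardsT card_ord leq_pred !inE -card_gt0 cardsT card_ord n_gt0.
Qed.

(** The two sizes are positive with sum [n], and one is at least [n - 1], so the other is 1. The
    factor [1 < n] excludes the case [n = 1], where [A] is a singleton with empty complement. *)
Lemma normalized2 A B : normalized H [:: A; B] =
  [&& B == ~: A, Ordinal n_gt0 \in A & (#|A| == 1%N) || (#|B| == 1%N)]
    && (1 < n)%N.
Proof.
rewrite /normalized /admissible has_edge_complete has_vertex1E.
rewrite /ordered_partition /= big_cons big_seq1 !andbT orbF -!card_gt0.
have cA := cardsC A; rewrite card_ord in cA.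
apply/idP/idP => [|/andP[/and3P[/eqP -> -> c1] n1]].
  case/andP=> /andP[/andP[/andP[A0 B0] /andP[dAB /eqP cAB]]] le_n -> /=.
  have BE : B = ~: A.
    apply/setP => x; have := in_setT x; rewrite -cAB !inE.
    by case: (boolP (x \in A)) => [/(disjointFr dAB)->|].
  rewrite BE eqxx /= in B0 le_n *.
  by move: #|A| #|~: A| cA A0 B0 le_n => a b; lia.
rewrite setUCr eqxx disjoints_subset setCK subxx !andbT.
by move: #|A| #|~: A| cA c1 => a b; lia.
Qed.

(** Outside a block with at least [n - 1] vertices there is at most one vertex, hence room for at
    most one further nonempty block. *)
Lemma normalized_size s : normalized H s -> (size s <= 2)%N.
Proof.
case/andP=> /andP[/and3P[/allP s0 /card_bigcup_pairwise card_s /eqP s_cover]].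
rewrite s_cover cardsT card_ord in card_s.
rewrite has_edge_complete => /hasP[B Bs le_n] _.
have: (size (rem B s) <= \sum_(A <- rem B s) #|A|)%N.
  rewrite -sum1_size [leqLHS]big_seq [leqRHS]big_seq; apply: leq_sum => A.
  by move/mem_rem/s0; rewrite card_gt0.
rewrite (big_rem B Bs) /= in card_s; rewrite size_rem //.
by move: (size s) #|B| (\sum_(A <- _) _)%N card_s le_n => k a b; lia.
Qed.

(** [Ordinal n_gt0] is vertex 1, whose block must come first in a normalized representative. *)
Definition vertex_pair (v : 'I_n) : 2.-tuple {set 'I_n} :=
  if v == Ordinal n_gt0 then [tuple [set v]; ~: [set v]]
  else [tuple ~: [set v]; [set v]].

(** For [2 < n] the complement of a singleton is not a singleton, so the pair determines [v]. For
    [n = 2] both vertices give the same pair. *)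
Lemma vertex_pair_inj : (2 < n)%N -> injective vertex_pair.
Proof.
move=> n2 v w /(congr1 val); rewrite /vertex_pair.
have c1 x : #|~: [set x : 'I_n]| != 1%N by rewrite cardsC1 card_ord; lia.
case: ifP; case: ifP => _ _ [] E E'; try exact: set1_inj.
  by have := c1 w; rewrite -E cards1.
by have := c1 v; rewrite E cards1.
Qed.

Lemma card_cell1 : #|{: cell H 1}| = 1%N.
Proof.
rewrite card_cell; apply/eqP/cards1P; exists [tuple [set: 'I_n]].
apply/setP => t; rewrite !inE; case/tupleP: t => A t; rewrite (tuple0 t).
by rewrite normalized1; apply/eqP/eqP => [->|/(congr1 val)[->]] //;
  apply: val_inj.
Qed.

Lemma card_cell2 : (2 < n)%N -> #|{: cell H 2}| = n.
Proof.
move=> n2; rewrite card_cell -[RHS]card_ord -(card_codom (vertex_pair_inj n2)).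
apply: eq_card => t; rewrite inE.
case/tupleP: t => A t; case/tupleP: t => B t; rewrite (tuple0 t) {t}.
rewrite normalized2 (ltnW n2) andbT.
apply/and3P/codomP => [[/eqP BE A0]|[v]].
  (* If the first block is the singleton, [v] is vertex 1; if the second is, [v] is another
     vertex. *)
  case/orP=> /cards1P[v vE]; exists v; apply: val_inj; rewrite /vertex_pair.
    by move: A0; rewrite BE vE inE eq_sym => ->.
  have AE : A = ~: [set v] by rewrite -vE BE setCK.
  by move: A0; rewrite vE AE !inE eq_sym => /negPf ->.
move/(congr1 val); rewrite /vertex_pair.
case: (v =P _) => [->|/eqP v0] /= [-> ->].
  by rewrite cards1 inE !eqxx.
by rewrite setCK cards1 !inE eq_sym v0 eqxx orbT.
Qed.

Lemma card_cell3 : #|{: cell H 3}| = 0%N.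
Proof.
apply: eq_card0 => b; have [sb /normalized_size] := cell_seqP b.
by rewrite sb.
Qed.

End CompleteHypergraph.

Theorem theorem3p5 (F : fieldType) (charF0 : [pchar F] =i pred0)
    (n : nat) (n_gt0 : (0 < n)%N) :
  ((2 < n)%N ->
     \dim (HC F (complete_uniform n n.-1) 0) = 'C(n, 1) /\ 'C(n, 1) = n) /\
  (\dim (HC F (complete_uniform n n.-1) (-1)) = 'C(n, 0) /\ 'C(n, 0) = 1%N).
Proof.
rewrite bin1 bin0; split=> [n2|]; split=> //; rewrite dim_HC_full.
- exact: card_cell2.
- by rewrite boundary_pair_eq0.
- by apply/lfunP => c; rewrite (chain_eq0 c (card_cell3 n_gt0)) !linear0.
- exact: card_cell1.
(* The boundary out of degree -1 lands in the chains with no blocks, which are zero. *)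
- by apply/lfunP => c; rewrite zero_lfunE; apply: chain0_eq0.
- by rewrite boundary_pair_eq0.
Qed.
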